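(* Let $n \ge 2$ be even. Then $|S_{1,1}(n)| - |S_{0,0}(n)|$ equals the number of irreducible polynomials of degree $n/2$ in $\mathbb{F}_2[x]$ whose coefficient of $x^{n/2-1}$ is $1$. Moreover, \[ |S_{1,1}(n)| - |S_{0,0}(n)| = \frac{1}{n}\sum_{\substack{d \mid n/2 \\ d \text{ odd}}} \mu(d)\, 2^{n/(2d)}, \] where $\mu$ is the Möbius function.
   Context: For $n \ge 2$, let $\mathcal{I}_n$ be the set of all irreducible polynomials of degree $n$ in $\mathbb{F}_2[x]$. Every $f \in \mathcal{I}_n$ is monic with constant term $1$; write $f = x^n + f_{n-1}x^{n-1} + \cdots + f_1 x + 1$ with $f_k \in \mathbb{F}_2$. The coefficient $f_{n-1}$ is the trace of $f$ and $f_1$ is its cotrace. For $i,j \in \mathbb{F}_2$, $S_{i,j}(n)$ denotes the set of $f \in \mathcal{I}_n$ with $f_{n-1} = i$ and $f_1 = j$. The trace of a monic irreducible polynomial of degree $m$ is its coefficient of $x^{m-1}$; for $m=1$ the trace-$1$ irreducible is $x+1$. The Möbius function is $\mu(1)=1$, $\mu(m)=(-1)^k$ if $m$ is a product of $k$ distinct primes, and $\mu(m)=0$ otherwise. *)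

(* Defs.v *)
From mathcomp Require Import all_boot all_algebra all_field.
From mathcomp Require Import boolp.
Set Implicit Arguments. Unset Strict Implicit. Unset Printing Implicit Defensive.
Import GRing.Theory.
Local Open Scope ring_scope.

(* The monic polynomial x^m + c_{m-1} x^{m-1} + ... + c_0 over F_2,
   from its coefficient tuple c = (c_0, ..., c_{m-1}). Every monic polynomial
   of degree m arises from exactly one such tuple. *)
Definition mkpoly (m : nat) (c : m.-tuple 'F_2) : {poly 'F_2} :=
  'X^m + \poly_(i < m) c`_i.

Definition Irr (m : nat) : {set m.-tuple 'F_2} :=
  [set c | `[< irreducible_poly (mkpoly c) >]].

Definition Sij (n : nat) (i j : 'F_2) : {set n.-tuple 'F_2} :=
  [set c in Irr n | ((mkpoly c)`_n.-1 == i) && ((mkpoly c)`_1 == j)].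

Definition IrrTr1 (m : nat) : {set m.-tuple 'F_2} :=
  [set c in Irr m | (mkpoly c)`_m.-1 == 1].

Definition moebius (m : nat) : int :=
  if m == 0%N then 0
  else if all (fun p => logn p m == 1%N) (primes m)
       then (-1) ^+ size (primes m) else 0.

(* Main.v *)
Require Import Defs.
From mathcomp Require Import all_boot all_algebra all_field.
From mathcomp Require Import boolp ring zify.
Set Implicit Arguments. Unset Strict Implicit. Unset Printing Implicit Defensive.
Import GRing.Theory Num.Theory.
Local Open Scope ring_scope.

(* Reversing coefficients gives |S_{0,1}(n)| = |S_{1,0}(n)|, so the difference
   |S_{1,1}(n)| - |S_{0,0}(n)| is 2 T(n) - A(n), where T counts the irreducible
   polynomials of trace 1 and A all of them.  The irreducible polynomials of
   degree d | n correspond to the Frobenius orbits of size d in the field of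
   2^n elements; on such an orbit the absolute trace is n/d times the trace of
   the polynomial.  Counting all elements, and those of absolute trace 1, gives
     sum_{d | n} d A(d) = 2^n,   sum_{d | n, n/d odd} d T(d) = 2^(n-1).
   Hence both g(m) = 2m T(m) and g(m) = 2m (2 T(2m) - A(2m)) satisfy
     sum_{k | m, k odd} g(m/k) = 2^m,
   and Moebius inversion over odd divisors determines g. *)

(** * Monic polynomials over F_2 and their coefficient tuples *)

Lemma F2_cases (a : 'F_2) : a = 0 \/ a = 1.
Proof.
by case: a => [[|[|k]] Hk] //; [left|right]; apply: val_inj.
Qed.

Lemma size_mkpoly m (c : m.-tuple 'F_2) : size (mkpoly c) = m.+1.
Proof. by rewrite /mkpoly size_polyDl size_polyXn // ltnS size_poly. Qed.

Lemma mkpoly_monic m (c : m.-tuple 'F_2) : mkpoly c \is monic.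
Proof.
by rewrite monicE lead_coefE size_mkpoly coefD coefXn eqxx coef_poly ltnn addr0.
Qed.

Lemma coef_mkpoly m (c : m.-tuple 'F_2) i : (i < m)%N -> (mkpoly c)`_i = c`_i.
Proof. by move=> lim; rewrite coefD coefXn coef_poly lim ltn_eqF // add0r. Qed.

Lemma mkpoly_inj m : injective (@mkpoly m).
Proof.
move=> c1 c2 eqc; apply/val_inj/(@eq_from_nth _ 0) => [|i]; last first.
  by rewrite size_tuple => lim; rewrite -!coef_mkpoly // eqc.
by rewrite !size_tuple.
Qed.

Lemma mkpolyK m (h : {poly 'F_2}) : h \is monic -> size h = m.+1 ->
  mkpoly [tuple h`_i | i < m] = h.
Proof.
move=> /monicP; rewrite lead_coefE => mh sh; rewrite sh /= in mh.
apply/polyP => i; have [lim|] := ltnP i m.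
  by rewrite coef_mkpoly // -(tnth_nth 0 _ (Ordinal lim)) tnth_mktuple.
rewrite leq_eqVlt => /predU1P[<-|lt_mi]; last first.
  by rewrite !nth_default ?size_mkpoly ?sh.
rewrite mh; have := mkpoly_monic [tuple h`_i | i < m].
by rewrite monicE lead_coefE size_mkpoly => /eqP.
Qed.

Lemma irr_mkpolyP m (c : m.-tuple 'F_2) :
  reflect (irreducible_poly (mkpoly c)) (c \in Irr m).
Proof. by rewrite inE; apply: asboolP. Qed.

(** * Frobenius orbits and irreducible polynomials over F_2 *)

Section FrobeniusOrbits.

Variables (L : finFieldType) (iota : {rmorphism 'F_2 -> L}).

Lemma pchar2 : 2%N \in [pchar L].
Proof. by apply: (rmorph_pchar iota); rewrite pchar_Fp. Qed.

Local Notation Frob := (pFrobenius_aut pchar2).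
Local Notation "p ^io" := (map_poly iota p) (at level 2, format "p ^io").

Lemma Frob_inj : injective Frob.
Proof. exact: fmorph_inj. Qed.

Lemma iter_Frob k x : iter k Frob x = x ^+ (2 ^ k).
Proof.
elim: k => [|k IHk]; first by rewrite expr1.
by rewrite iterS IHk pFrobenius_autE -exprM expnSr.
Qed.

Lemma Frob_iota a : Frob (iota a) = iota a.
Proof. by case: (F2_cases a) => ->; rewrite ?rmorph0 ?rmorph1. Qed.

Lemma Frob_fixed x : Frob x = x -> x = iota 0 \/ x = iota 1.
Proof.
rewrite pFrobenius_autE rmorph0 rmorph1 => /eqP; rewrite -subr_eq0.
have -> : x ^+ 2 - x = x * (x - 1) by rewrite mulrBr mulr1 expr2.
by rewrite mulf_eq0 subr_eq0 => /orP[] /eqP; [left | right].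
Qed.

Lemma root_Frob (p : {poly 'F_2}) x : root p^io x -> root p^io (Frob x).
Proof.
(* [Frob] fixes the coefficients, which come from F_2, so [p^io] is its own image. *)
have {2}-> : p^io = map_poly Frob p^io.
  by apply/polyP => i; rewrite !coef_map /= Frob_iota.
by move=> rx; rewrite rmorph_root.
Qed.

Lemma root_orbit (p : {poly 'F_2}) x :
  root p^io x -> all (root p^io) (orbit Frob x).
Proof.
move=> rx; apply/allP => y /trajectP[i _ ->].
by elim: i => //= i; apply: root_Frob.
Qed.

(** This is the minimal polynomial of [x] over F_2, seen in [L], as [irreducible_orbit_poly] and
    [irreducible_root] establish. *)
Definition orbit_poly x := \prod_(y <- orbit Frob x) ('X - y%:P).

Lemma orbit_poly_monic x : orbit_poly x \is monic.
Proof. exact: monic_prod_XsubC. Qed.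

Lemma size_orbit_poly x : size (orbit_poly x) = (order Frob x).+1.
Proof. by rewrite size_prod_XsubC size_orbit. Qed.

Lemma root_orbit_poly x y : root (orbit_poly x) y = (y \in orbit Frob x).
Proof. exact: root_prod_XsubC. Qed.

Lemma perm_Frob_orbit x : perm_eq [seq Frob y | y <- orbit Frob x] (orbit Frob x).
Proof.
have Umap : uniq [seq Frob y | y <- orbit Frob x].
  by rewrite map_inj_uniq ?orbit_uniq //; apply: Frob_inj.
apply: uniq_perm => //; first exact: orbit_uniq.
have sub : {subset [seq Frob y | y <- orbit Frob x] <= orbit Frob x}.
  by move=> y /mapP[z zx ->]; apply: mem_orbit.
by have [|] := uniq_min_size Umap sub; rewrite ?size_map.
Qed.

(** Frobenius permutes the roots of [orbit_poly x], so it fixes the coefficients, and its only fixed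
    points are 0 and 1. *)
Lemma orbit_poly_descends x : exists h : {poly 'F_2}, h^io = orbit_poly x.
Proof.
have fixP i : Frob (orbit_poly x)`_i = (orbit_poly x)`_i.
  rewrite -coef_map /orbit_poly map_prod_XsubC.
  rewrite -(big_map Frob xpredT (fun y => 'X - y%:P)).
  by rewrite (perm_big _ (perm_Frob_orbit x)).
exists (\poly_(i < size (orbit_poly x))
          (if (orbit_poly x)`_i == 0 then 0 else 1)).
apply/polyP => i; rewrite coef_map coef_poly /=.
case: ltnP => [_|le_i]; last by rewrite rmorph0 nth_default.
case: eqP => [->|]; first by rewrite rmorph0.
by case: (Frob_fixed (fixP i)) => -> //; rewrite rmorph0.
Qed.

Lemma dvdp_orbit_poly (p : {poly 'F_2}) x : root p^io x ->
  orbit_poly x %| p^io.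
Proof.
move=> rx; have [|q ->] := uniq_roots_prod_XsubC (root_orbit rx).
  by rewrite uniq_rootsE orbit_uniq.
exact: dvdp_mull.
Qed.

(** A nonconstant divisor of [h] has a root in the orbit of [x]. Its roots are stable under
    Frobenius, so [x] is one of them, and [orbit_poly x] divides it in turn. *)
Lemma irreducible_orbit_poly (h : {poly 'F_2}) x :
  h^io = orbit_poly x -> irreducible_poly h.
Proof.
move=> hx; have sh : size h = (order Frob x).+1.
  by rewrite -size_orbit_poly -hx size_map_poly.
have h0 : h != 0 by rewrite -size_poly_gt0 sh.
split=> [|q sq qh]; first by rewrite sh ltnS order_gt0.
have q0 : q != 0 by apply: dvdpN0 qh h0.
(* A divisor of a product of linear factors is, up to a unit, the product of those kept by some mask
   [m]; since [q] is not constant, at least one is kept. *)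
have /dvdp_prod_XsubC[m qm] : q^io %| \prod_(y <- orbit Frob x) ('X - (id y)%:P).
  by rewrite -/(orbit_poly x) -hx dvdp_map.
have [y ym] : exists y, y \in mask m (orbit Frob x).
  case: (mask m _) qm => [|y s _]; last by exists y; rewrite mem_head.
  move=> /eqp_size; rewrite big_nil size_poly1 size_map_poly => /eqP.
  by rewrite (negPf sq).
have ry : root q^io y by rewrite (eqp_root qm) root_prod_XsubC.
have xy : x \in orbit Frob y.
  rewrite -fconnect_orbit fconnect_sym ?fconnect_orbit; last exact: Frob_inj.
  exact: mem_mask ym.
rewrite /eqp qh -(dvdp_map iota) hx dvdp_orbit_poly //.
exact: (allP (root_orbit ry)).
Qed.

(** The descent of [orbit_poly x] to F_2 is a nonconstant divisor of [h], hence associate to it, and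
    both are monic. *)
Lemma irreducible_root (h : {poly 'F_2}) x :
  h \is monic -> irreducible_poly h -> root h^io x -> h^io = orbit_poly x.
Proof.
move=> mh [sh irrh] rx; have [g gx] := orbit_poly_descends x.
have h0 : h != 0 := monic_neq0 mh.
have mg : g \is monic by rewrite -(map_monic iota) gx orbit_poly_monic.
have : g %= h.
  apply: irrh; last by rewrite -(dvdp_map iota) gx dvdp_orbit_poly.
  by rewrite -(size_map_poly iota) gx size_orbit_poly eqSS -lt0n order_gt0.
by rewrite eqp_monic // => /eqP <-.
Qed.

Lemma order_root_Irr d (c : d.-tuple 'F_2) x :
  c \in Irr d -> root (mkpoly c)^io x -> order Frob x = d.
Proof.
move=> /irr_mkpolyP irrc rx; apply: succn_inj; rewrite -size_orbit_poly.
by rewrite -(irreducible_root _ irrc rx) ?mkpoly_monic // size_map_poly size_mkpoly.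
Qed.

(** The only irreducible polynomial vanishing at [x] is the descent of [orbit_poly x], whose degree
    is the orbit size. The boolean on the right is read as 0 or 1. *)
Lemma card_Irr_root d x :
  #|[set c in Irr d | root (mkpoly c)^io x]| = (order Frob x == d).
Proof.
case: eqP => [<-|neq]; last first.
  apply: eq_card0 => c; rewrite inE; apply/negP => /andP[irrc rx].
  exact/neq/(order_root_Irr irrc rx).
have [g gx] := orbit_poly_descends x.
have mg : g \is monic by rewrite -(map_monic iota) gx orbit_poly_monic.
have sg : size g = (order Frob x).+1.
  by rewrite -(size_map_poly iota) gx size_orbit_poly.
apply: etrans (cards1 [tuple g`_i | i < order Frob x]); apply: eq_card => c.
rewrite !inE; apply/andP/eqP => [[/asboolP irrc rx]|->]; last first.
  rewrite mkpolyK // gx root_orbit_poly in_orbit; split=> //.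
  by apply/asboolP; apply: irreducible_orbit_poly gx.
apply: mkpoly_inj; rewrite mkpolyK //; apply: (map_poly_inj iota).
by rewrite gx (irreducible_root _ irrc rx) ?mkpoly_monic.
Qed.

Lemma order_Frob_dvd k x : iter k Frob x = x -> (order Frob x %| k)%N.
Proof.
set e := order Frob x; have e_gt0 : (0 < e)%N := order_gt0 _ _.
have fixe j : iter (j * e) Frob x = x.
  by elim: j => // j IHj; rewrite mulSn addnC iterD iter_order //; apply: Frob_inj.
rewrite {1}(divn_eq k e) addnC iterD fixe => fixk.
have := findex_iter (ltn_pmod k e_gt0); rewrite fixk findex0 => /esym/eqP.
by rewrite /dvdn.
Qed.

(** Inversion commutes with Frobenius and is an involution, so each of the two orders divides the
    other. *)
Lemma order_FrobV x : order Frob x^-1 = order Frob x.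
Proof.
have dvdV y : (order Frob y^-1 %| order Frob y)%N.
  apply: order_Frob_dvd; rewrite iter_Frob exprVn -iter_Frob iter_order //.
  exact: Frob_inj.
by apply/eqP; rewrite eqn_dvd dvdV -{1}(invrK x) dvdV.
Qed.

(** * Counting in the field with 2^n elements *)

Section Degree.

Variable n : nat.
Hypothesis n_gt0 : (0 < n)%N.
Hypothesis cardL : #|L| = (2 ^ n)%N.

Lemma order_Frob_dvdn x : (order Frob x %| n)%N.
Proof. by apply: order_Frob_dvd; rewrite iter_Frob -cardL expf_card. Qed.

(** In the field F_2[X]/(h) of 2^d elements, raising to the power 2^d is the identity, hence so is
    the power 2^n. Thus [h] divides X^(2^n) - X, which splits into linear factors over [L]. *)
Lemma irreducible_has_root (h : {poly 'F_2}) d : (d %| n)%N ->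
  h \is monic -> irreducible_poly h -> size h = d.+1 -> exists x, root h^io x.
Proof.
move=> dn mh irrh sh; pose hI : monic_irreducible_poly h := (irrh, mh).
have cardK : #|{poly %/ h with hI}| = (2 ^ d)%N.
  by rewrite card_qfpoly sh card_Fp.
have : h %| 'X^(2 ^ n) - 'X.
  have fixX : (in_qpoly h 'X : {poly %/ h with hI}) ^+ (2 ^ n) = in_qpoly h 'X.
    case/dvdnP: dn => k ->; elim: k => [|k IHk]; first by rewrite expr1.
    by rewrite mulSn addnC expnD exprM IHk -cardK expf_card.
  have /val_eqP : in_qpoly h ('X^(2 ^ n) - 'X) = 0.
    by rewrite rmorphB rmorphXn /= [_ ^+ _]fixX subrr.
  by rewrite /= (mk_monicE hI) dvdpE.
rewrite -(dvdp_map iota) rmorphB /= map_polyXn map_polyX -cardL finField_genPoly.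
rewrite -big_enum /= => /dvdp_prod_XsubC[m hm].
have [y ym] : exists y, y \in mask m (enum L).
  case: (mask m _) hm => [|y s _]; last by exists y; rewrite mem_head.
  move=> /eqp_size; rewrite big_nil size_poly1 size_map_poly => sh1.
  by have [] := irrh; rewrite sh1.
by exists y; rewrite (eqp_root hm) root_prod_XsubC.
Qed.

Lemma card_roots_Irr d (c : d.-tuple 'F_2) : (d %| n)%N -> c \in Irr d ->
  #|[set x | root (mkpoly c)^io x]| = d.
Proof.
move=> dn irrc; have /irr_mkpolyP irr_c := irrc; have mc := mkpoly_monic c.
have [x rx] := irreducible_has_root dn mc irr_c (size_mkpoly c).
have cx := irreducible_root mc irr_c rx.
rewrite -[RHS](order_root_Irr irrc rx) -size_orbit.
rewrite -(card_uniqP (orbit_uniq Frob x)).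
by apply: eq_card => y; rewrite inE cx root_orbit_poly.
Qed.

Lemma coef_root_Irr d (c : d.-tuple 'F_2) x : c \in Irr d ->
  root (mkpoly c)^io x -> iota (mkpoly c)`_d.-1 = \sum_(y <- orbit Frob x) y.
Proof.
move=> irrc rx; have /irr_mkpolyP irr_c := irrc.
rewrite -coef_map (irreducible_root (mkpoly_monic c) irr_c rx).
(* Vieta's formula for the sum of the roots; its minus sign disappears in characteristic 2. *)
have /coefPn_prod_XsubC : size (orbit Frob x) != 0%N.
  by rewrite size_orbit -lt0n order_gt0.
by rewrite size_orbit (order_root_Irr irrc rx) (oppr_pchar2 pchar2).
Qed.

(** Double counting of pairs of an irreducible polynomial and a root: an element of order [d]
    belongs to one polynomial, and a polynomial of degree [d] has [d] roots. The predicate [P] on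
    the orbit sum lets one argument serve both the count of all elements and that of elements of
    trace 1. *)
Lemma card_order_Frob d (P : pred L) : (d %| n)%N ->
  #|[set x | (order Frob x == d) && P (\sum_(y <- orbit Frob x) y)]|
  = (d * #|[set c in Irr d | P (iota (mkpoly c)`_d.-1)%R]|)%N.
Proof.
move=> dn; pose Q x (c : d.-tuple 'F_2) :=
  [&& c \in Irr d, root (mkpoly c)^io x & P (iota (mkpoly c)`_d.-1)].
have cardQ x : (\sum_(c | Q x c) 1)%N =
    ((order Frob x == d) && P (\sum_(y <- orbit Frob x) y)).
  rewrite sum1_card; case: (boolP (P _)) => [Px|nPx].
    rewrite andbT -card_Irr_root; apply: eq_card => c; rewrite !inE -topredE /= /Q.
    case: (boolP (c \in Irr d)) => irrc; last first.
      by rewrite inE in irrc; rewrite (negPf irrc).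
    move: (irrc); rewrite inE => ->; case rx: (root _ x) => //=.
    by rewrite (coef_root_Irr irrc rx) Px.
  rewrite andbF; apply: eq_card0 => c; apply/negP => /and3P[irrc rx].
  by rewrite (coef_root_Irr irrc rx) (negPf nPx).
rewrite -sum1dep_card big_mkcond /=.
under eq_bigr => x _ do rewrite -[if _ then _ else _]/(nat_of_bool _) -cardQ.
rewrite (exchange_big_dep
  (fun c => (c \in Irr d) && P (iota (mkpoly c)`_d.-1))) /=; last first.
  by move=> x c _ /and3P[-> _ ->].
rewrite mulnC -sum_nat_const; apply: eq_big => [c|c]; first by rewrite !inE.
case/andP=> irrc Pc; rewrite sum1_card -[RHS](card_roots_Irr dn irrc).
by apply: eq_card => x; rewrite inE -topredE /= /Q irrc Pc andbT.
Qed.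

(** The orbit size divides [n], so the first [n] iterates run round the orbit a whole number of
    times. *)
Lemma sum_iter_Frob x : \sum_(i < n) iter i Frob x =
  (\sum_(y <- orbit Frob x) y) *+ (n %/ order Frob x).
Proof.
have sumE k y : \sum_(z <- traject Frob y k) z = \sum_(i < k) iter i Frob y.
  elim: k => [|k IHk]; first by rewrite big_nil big_ord0.
  by rewrite trajectSr -cats1 big_cat big_seq1 big_ord_recr IHk.
have /dvdnP[k ->] := order_Frob_dvdn x; rewrite mulnK ?order_gt0 //.
rewrite /orbit sumE; elim: k => [|k IHk]; first by rewrite big_ord0.
rewrite mulSn big_split_ord /= mulrS -IHk; congr (_ + _).
apply: eq_bigr => i _; rewrite addnC iterD iter_order //; exact: Frob_inj.
Qed.

(** The trace takes only the values 0 and 1, and is given by a polynomial of degree 2^(n-1), so each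
    fibre has at most 2^(n-1) elements. Together the two fibres have 2^n, so both bounds are
    attained. *)
Lemma card_trace1 : #|[set x : L | \sum_(i < n) iter i Frob x == 1]| = (2 ^ n.-1)%N.
Proof.
pose tr x := \sum_(i < n) iter i Frob x.
pose T : {poly L} := \sum_(i < n) 'X^(2 ^ i).
have trT x : T.[x] = tr x.
  by rewrite horner_sum; apply: eq_bigr => i _; rewrite hornerXn iter_Frob.
have tr01 x : tr x = 0 \/ tr x = 1.
  rewrite -(rmorph0 iota) -(rmorph1 iota); apply: Frob_fixed.
  (* Frobenius shifts the [n] summands cyclically, because x^(2^n) = x. *)
  rewrite /tr -(prednK n_gt0) rmorph_sum big_ord_recr big_ord_recl /= addrC.
  rewrite -iterS prednK // iter_Frob -cardL expf_card.
  by congr (_ + _); apply: eq_bigr.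
have cardle c : (#|[set x | tr x == c]| <= 2 ^ n.-1)%N.
  have sT : (size (T - c%:P)%R = (2 ^ n.-1).+1)%N.
    rewrite /T -(prednK n_gt0) big_ord_recr /= -addrA addrCA.
    rewrite size_polyDl size_polyXn //.
    rewrite ltnS (leq_trans (size_polyD _ _)) // geq_max size_polyN.
    rewrite (leq_trans (size_polyC_leq1 _)) ?expn_gt0 // andbT.
    rewrite (leq_trans (size_sum _ _ _)) //; apply/bigmax_leqP => i _.
    by rewrite size_polyXn ltn_exp2l.
  rewrite -ltnS -sT cardE; apply: max_poly_roots; rewrite ?enum_uniq //.
    by rewrite -size_poly_gt0 sT.
  apply/allP => x; rewrite mem_enum inE => /eqP trx.
  by rewrite /root !hornerE trT trx subrr.
change (#|[set x | tr x == 1]| = (2 ^ n.-1)%N).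
apply/eqP; rewrite eqn_leq cardle /= -(leq_add2l #|[set x | tr x == 0]|).
rewrite -cardsUI [_ :&: _](_ : _ = set0) ?cards0 ?addn0; last first.
  by apply/setP => x; rewrite !inE; apply/andP => -[/eqP-> ]; rewrite eq_sym oner_eq0.
rewrite [_ :|: _](_ : _ = setT) ?cardsT ?cardL; last first.
  by apply/setP => x; rewrite !inE; case: (tr01 x) => ->; rewrite eqxx ?orbT.
rewrite -[X in (_ <= 2 ^ X)%N](prednK n_gt0) expnS mul2n -addnn.
by rewrite leq_add2r cardle.
Qed.

Lemma sum_order_Frob (Q : pred L) :
  #|[set x | Q x]| =
  (\sum_(d <- divisors n) #|[set x | (order Frob x == d) && Q x]|)%N.
Proof.
rewrite -sum1dep_card.
under [RHS]eq_bigr => d _ do rewrite -sum1dep_card big_mkcondr /=.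
rewrite (exchange_big_dep xpredT) //= big_mkcond /=; apply: eq_bigr => x _.
rewrite big_mkcond (bigD1_seq (order Frob x)) /= ?divisors_uniq //; last first.
  by rewrite -dvdn_divisors // order_Frob_dvdn.
by rewrite eqxx big1 ?addn0 // => d; rewrite eq_sym => /negPf->.
Qed.

Lemma sum_card_Irr_card : (\sum_(d <- divisors n) d * #|Irr d| = 2 ^ n)%N.
Proof.
rewrite -cardL -cardsT sum_order_Frob !big_seq; apply: eq_bigr => d.
rewrite -dvdn_divisors // => /(card_order_Frob xpredT) ->; congr (_ * _)%N.
by apply: eq_card => c; rewrite !inE andbT.
Qed.

(** In characteristic 2 only the parity of n/d matters: the absolute trace is 1 exactly when n/d is
    odd and the orbit sum is 1. *)
Lemma sum_card_IrrTr1_card :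
  (\sum_(d <- divisors n | odd (n %/ d)) d * #|IrrTr1 d| = 2 ^ n.-1)%N.
Proof.
rewrite -card_trace1 sum_order_Frob big_mkcond !big_seq; apply: eq_bigr => d.
rewrite -dvdn_divisors // => dn.
have natodd (y : L) k : y *+ k = y *+ odd k.
  rewrite -{1}(odd_double_half k) mulrnDr -mul2n mulrnA (mulrn_pchar pchar2).
  by rewrite mul0rn addr0.
have -> : (if odd (n %/ d) then d * #|IrrTr1 d| else 0)%N = 
  (d * #|[set c in Irr d | odd (n %/ d) && (iota (mkpoly c)`_d.-1 == 1)%R]|)%N.
  case: ifP => _ /=; last first.
    by rewrite eq_card0 ?muln0 // => c; rewrite !inE andbF.
  congr (_ * _)%N; apply: eq_card => c; rewrite !inE.
  by rewrite -(rmorph1 iota) (inj_eq (fmorph_inj iota)).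
rewrite -(card_order_Frob (fun y => odd (n %/ d) && (y == 1))) //.
apply: eq_card => x; rewrite !inE sum_iter_Frob.
case: eqP => //= ->; rewrite natodd; case: odd => //=.
by rewrite mulr0n eq_sym oner_eq0.
Qed.

(* If [x] is a root of [mkpoly c], then [x^-1] is a root of its reversal and
   has a Frobenius orbit of the same size. *)
Lemma irreducible_reverse_card (c : n.-tuple 'F_2) :
  c \in Irr n -> (mkpoly c)`_0 = 1 ->
  [tuple (mkpoly c)`_(n - i) | i < n] \in Irr n.
Proof.
move=> irrc c0; set c' := [tuple _ | _ < _].
have [x rx] : exists x, root (mkpoly c)^io x.
  apply: (irreducible_has_root (dvdnn n) (mkpoly_monic c)) (size_mkpoly c).
  exact/irr_mkpolyP.
have ordx := order_root_Irr irrc rx.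
have coefc' i : (i <= n)%N -> (mkpoly c')`_i = (mkpoly c)`_(n - i).
  rewrite leq_eqVlt => /predU1P[->|lin]; last first.
    by rewrite coef_mkpoly // -(tnth_nth 0 _ (Ordinal lin)) tnth_mktuple.
  have := mkpoly_monic c'; rewrite monicE lead_coefE size_mkpoly => /eqP->.
  by rewrite subnn.
have x0 : x != 0.
  apply: contraTneq rx => ->; rewrite /root horner_coef0 coef_map c0 /= rmorph1.
  exact: oner_neq0.
have rx' : root (mkpoly c')^io x^-1.
  rewrite /root horner_coef size_map_poly size_mkpoly.
  rewrite -(mulrI_eq0 _ (mulfI (expf_neq0 n x0))) mulr_sumr.
  move: rx; rewrite /root horner_coef size_map_poly size_mkpoly.
  rewrite (reindex_inj rev_ord_inj) /=; congr (_ == _); apply: eq_bigr => i _.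
  rewrite !coef_map coefc' ?subSS ?leq_ord // mulrCA; congr (_ * _).
  by rewrite exprVn; apply: expfB_cond; rewrite (negPf x0) leq_ord.
(* The orbit polynomial of [x^-1] divides the reversal and has the same degree, so the two monic
   polynomials coincide. *)
apply/irr_mkpolyP/(@irreducible_orbit_poly _ x^-1)/eqP.
rewrite -eqp_monic ?orbit_poly_monic ?map_monic ?mkpoly_monic // eqp_sym.
rewrite -dvdp_size_eqp; last by rewrite dvdp_orbit_poly // monic_neq0 ?mkpoly_monic.
by rewrite size_orbit_poly order_FrobV ordx size_map_poly size_mkpoly.
Qed.

End Degree.

End FrobeniusOrbits.

(** * Elimination of the auxiliary field from the counts *)

Lemma exists_F2_extension n : (0 < n)%N ->
  exists (L : finFieldType) (iota : {rmorphism 'F_2 -> L}), #|L| = (2 ^ n)%N.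
Proof.
move=> n_gt0; have [K chK cardK] := @pPrimePowerField 2 n isT n_gt0.
by exists (pPrimeCharType chK), (GRing.in_alg (pPrimeCharType chK)).
Qed.

Lemma sum_card_Irr n : (0 < n)%N ->
  (\sum_(d <- divisors n) d * #|Irr d| = 2 ^ n)%N.
Proof.
move=> n_gt0; have [L [iota cardL]] := exists_F2_extension n_gt0.
exact: sum_card_Irr_card cardL.
Qed.

Lemma sum_card_IrrTr1 n : (0 < n)%N ->
  (\sum_(d <- divisors n | odd (n %/ d)) d * #|IrrTr1 d| = 2 ^ n.-1)%N.
Proof.
move=> n_gt0; have [L [iota cardL]] := exists_F2_extension n_gt0.
exact: sum_card_IrrTr1_card cardL.
Qed.

Lemma irreducible_reverse n (c : n.-tuple 'F_2) : (0 < n)%N ->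
  c \in Irr n -> (mkpoly c)`_0 = 1 ->
  [tuple (mkpoly c)`_(n - i) | i < n] \in Irr n.
Proof.
move=> n_gt0; have [L [iota cardL]] := exists_F2_extension n_gt0.
exact: irreducible_reverse_card cardL c.
Qed.

(** * Reversal, trace and cotrace *)

Lemma coef0_Irr n (c : n.-tuple 'F_2) :
  (1 < n)%N -> c \in Irr n -> (mkpoly c)`_0 = 1.
Proof.
move=> n_gt1 /irr_mkpolyP [_ irrc]; case: (F2_cases (mkpoly c)`_0) => // c0.
have X_dvd : 'X %| mkpoly c.
  by rewrite -['X]subr0 -polyC0 dvdp_XsubCl /root horner_coef0 c0.
have := eqp_size (irrc 'X _ X_dvd); rewrite size_polyX size_mkpoly => /(_ isT) [n1].
by rewrite -n1 in n_gt1.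
Qed.

Lemma in_Sij n i j (c : n.-tuple 'F_2) :
  (c \in Sij n i j) =
  [&& c \in Irr n, (mkpoly c)`_n.-1 == i & (mkpoly c)`_1 == j].
Proof. by rewrite [LHS]in_set. Qed.

(** Reversal of the coefficients exchanges trace and cotrace and is injective on irreducible
    polynomials. An inequality suffices, since exchanging [i] and [j] gives the converse. *)
Lemma card_Sij_swap_le n (i j : 'F_2) : (1 < n)%N ->
  (#|Sij n i j| <= #|Sij n j i|)%N.
Proof.
move=> n_gt1; have n_gt0 := ltnW n_gt1.
pose rv (c : n.-tuple 'F_2) := [tuple (mkpoly c)`_(n - i) | i < n].
have coef_rv c k : (k < n)%N -> (mkpoly (rv c))`_k = (mkpoly c)`_(n - k).
  by move=> lkn; rewrite coef_mkpoly // -(tnth_nth 0 _ (Ordinal lkn)) tnth_mktuple.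
have rv_inj : {in Sij n i j &, injective rv}.
  move=> c1 c2; rewrite !in_Sij => /andP[irr1 _] /andP[irr2 _] eqrv.
  apply: mkpoly_inj; apply/polyP => k.
  have [lenk|ltkn] := leqP n k.
    have := mkpoly_monic c1; have := mkpoly_monic c2.
    rewrite !monicE !lead_coefE !size_mkpoly => /eqP m2 /eqP m1.
    move: lenk; rewrite leq_eqVlt => /predU1P[<-|ltnk]; first by rewrite m1 m2.
    by rewrite !nth_default ?size_mkpoly.
  (* The tuple [rv c] holds the coefficients of index 1 to [n] only; the constant coefficient is
     recovered from irreducibility. *)
  have [->|k_gt0] := posnP k; first by rewrite !coef0_Irr.
  by rewrite -(subKn (ltnW ltkn)) -!coef_rv ?eqrv // ltn_subrL k_gt0 n_gt0.
rewrite -(card_in_imset rv_inj); apply/subset_leq_card/subsetP => _ /imsetP[c cS ->].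
move: cS; rewrite in_Sij => /and3P[irrc ci cj].
rewrite in_Sij (irreducible_reverse n_gt0 irrc (coef0_Irr n_gt1 irrc)) /=.
rewrite !coef_rv ?ltn_predL // subn1 ci andbT.
by have -> : (n - n.-1 = 1)%N by lia.
Qed.

(** Splitting by trace and cotrace, [IrrTr1 n] has S10 + S11 elements and [Irr n] has S00 + S01 +
    S10 + S11; the mixed terms cancel because S01 = S10. *)
Lemma card_S11_sub_S00 n : (1 < n)%N ->
  #|Sij n 1 1|%:Z - #|Sij n 0 0|%:Z = #|IrrTr1 n|%:Z *+ 2 - #|Irr n|%:Z.
Proof.
move=> n_gt1.
have S01 : #|Sij n 0 1| = #|Sij n 1 0|.
  by apply/eqP; rewrite eqn_leq !card_Sij_swap_le.
have cardT (i : 'F_2) :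
    #|[set c in Irr n | (mkpoly c)`_n.-1 == i]| =
    (#|Sij n i 0%R| + #|Sij n i 1%R|)%N.
  rewrite -cardsUI [_ :&: _](_ : _ = set0) ?cards0 ?addn0; last first.
    apply/setP => c; rewrite !inE; apply/negP.
    by move=> /andP[/andP[_ /andP[_ /eqP->]] /andP[_ /andP[_]]].
  apply: eq_card => c; rewrite !inE -andb_orr -andb_orr.
  by case: (F2_cases (mkpoly c)`_1) => ->; rewrite /= andbT.
have cardI : #|Irr n| =
    (#|[set c in Irr n | ((mkpoly c)`_n.-1 == 0)%R]| + #|IrrTr1 n|)%N.
  rewrite -cardsUI [_ :&: _](_ : _ = set0) ?cards0 ?addn0; last first.
    by apply/setP => c; rewrite !inE; apply/negP => /andP[/andP[_ /eqP->] /andP[_]].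
  apply: eq_card => c; rewrite !inE -andb_orr.
  by case: (F2_cases (mkpoly c)`_n.-1) => ->; rewrite /= andbT.
have := cardT 1; rewrite -/(IrrTr1 n) cardI cardT => ->.
by rewrite S01 mulr2n !PoszD; ring.
Qed.

(** * Reindexing of divisor sums and Moebius inversion *)

Lemma perm_divisors_mul d m : (0 < m)%N -> (d %| m)%N ->
  perm_eq [seq (d * k)%N | k <- divisors (m %/ d)]
          [seq e <- divisors m | (d %| e)%N].
Proof.
move=> m_gt0 dm; have d_gt0 := dvdn_gt0 m_gt0 dm.
have md_gt0 : (0 < m %/ d)%N by rewrite divn_gt0 // dvdn_leq.
apply: uniq_perm => [||e].
- rewrite map_inj_uniq ?divisors_uniq // => x y /eqP.
  by rewrite eqn_pmul2l // => /eqP.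
- by rewrite filter_uniq ?divisors_uniq.
rewrite mem_filter -dvdn_divisors //; apply/mapP/andP => [[k]|[/dvdnP[k ->]]].
  by rewrite -dvdn_divisors // dvdn_divRL // mulnC => km ->; rewrite dvdn_mulr.
by move=> km; exists k; [rewrite -dvdn_divisors // dvdn_divRL | rewrite mulnC].
Qed.

Lemma perm_divisors_codiv n : (0 < n)%N ->
  perm_eq [seq (n %/ d)%N | d <- divisors n] (divisors n).
Proof.
move=> n_gt0.
have invo d : d \in divisors n -> (n %/ (n %/ d))%N = d.
  by rewrite -dvdn_divisors // => dn; rewrite divnA // mulKn.
apply: uniq_perm => [||e]; last 1 first.
- apply/mapP/idP => [[d dn ->]|en].
    by rewrite -dvdn_divisors // dvdn_div // dvdn_divisors.
  exists (n %/ e)%N; rewrite ?invo // -dvdn_divisors //.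
  by rewrite dvdn_div // dvdn_divisors.
- rewrite map_inj_in_uniq ?divisors_uniq // => x y xn yn eqxy.
  by rewrite -(invo x) // eqxy invo.
- exact: divisors_uniq.
Qed.

Lemma sum_codiv (n : nat) (P : pred nat) (F : nat -> int) : (0 < n)%N ->
  \sum_(d <- divisors n | P d) F (n %/ d)%N
  = \sum_(d <- divisors n | P (n %/ d)%N) F d.
Proof.
move=> n_gt0; rewrite -[RHS](perm_big _ (perm_divisors_codiv n_gt0)) big_map.
rewrite big_seq_cond [RHS]big_seq_cond; apply: eq_bigl => d.
case: (boolP (_ \in _)) => //; rewrite -dvdn_divisors // => dn.
by rewrite divnA // mulKn.
Qed.

Lemma moebius_mul_prime p e : prime p -> (0 < e)%N -> ~~ (p %| e)%N ->
  moebius (p * e) = - moebius e.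
Proof.
move=> p_pr e_gt0 npe; have p_gt0 := prime_gt0 p_pr.
have Pperm : perm_eq (primes (p * e)) (p :: primes e).
  apply: uniq_perm; rewrite ?primes_uniq //=.
    by rewrite primes_uniq mem_primes p_pr e_gt0 (negPf npe).
  by move=> q; rewrite primesM // primes_prime // !inE.
have pe_gt0 : (0 < p * e)%N by rewrite muln_gt0 p_gt0.
rewrite /moebius (gtn_eqF pe_gt0) (gtn_eqF e_gt0).
rewrite (perm_all _ Pperm) (perm_size Pperm) /=.
have -> : logn p (p * e) = 1%N.
  by rewrite lognM // logn_prime // eqxx lognE (negPf npe) !andbF.
rewrite eqxx /=.
have -> : all (fun q => logn q (p * e) == 1%N) (primes e) =
          all (fun q => logn q e == 1%N) (primes e).
  apply: eq_in_all => q; rewrite mem_primes => /and3P[q_pr _ qe].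
  rewrite lognM // logn_prime // (_ : q == p = false) //.
  by apply: contraNF npe => /eqP<-.
by case: all; rewrite ?oppr0 // exprS mulN1r.
Qed.

Lemma moebius_square p d : prime p -> (p ^ 2 %| d)%N -> moebius d = 0.
Proof.
move=> p_pr p2d; rewrite /moebius; case: eqP => // /eqP; rewrite -lt0n => d_gt0.
rewrite pfactor_dvdn // in p2d.
case: allP => // /(_ p); rewrite -logn_gt0 (leq_trans _ p2d) // => /(_ isT) /eqP lp.
by rewrite lp in p2d.
Qed.

(** For a prime [p] dividing [n], the divisors divisible by [p] are the p k with k dividing n/p.
    Those with [p] dividing k contribute 0, and the others cancel against the divisors of [n] prime
    to [p]. *)
Lemma sum_moebius n : (0 < n)%N ->
  \sum_(d <- divisors n) moebius d = (n == 1%N)%:R.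
Proof.
move=> n_gt0; have [->|n_neq1] := eqVneq n 1%N; first by rewrite big_seq1.
have p_pr : prime (pdiv n) by rewrite pdiv_prime // ltn_neqAle eq_sym n_neq1.
have pn := pdiv_dvd n; set p := pdiv n in p_pr pn.
rewrite (bigID (fun d => p %| d)%N) /= -big_filter.
rewrite -(perm_big _ (perm_divisors_mul n_gt0 pn)) big_map.
rewrite (bigID (fun k => p %| k)%N) /= big1 ?add0r; last first.
  by move=> k pk; apply: (@moebius_square p) => //; rewrite expnS expn1 dvdn_mul.
apply/eqP; rewrite addr_eq0 -sumrN; apply/eqP.
rewrite -big_filter -[RHS]big_filter.
transitivity (\sum_(k <- [seq k <- divisors n | ~~ (p %| k)%N]) moebius (p * k)).
  apply: perm_big; apply: uniq_perm => [||k]; rewrite ?filter_uniq ?divisors_uniq //.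
  rewrite !mem_filter; case: (boolP (_ %| _)%N) => //= npk.
  have np_gt0 : (0 < n %/ p)%N by rewrite divn_gt0 ?prime_gt0 // dvdn_leq.
  rewrite -!dvdn_divisors // -{2}(divnK pn) Gauss_dvdl //.
  by rewrite coprime_sym prime_coprime.
rewrite !big_filter big_seq_cond [RHS]big_seq_cond; apply: eq_bigr => k /andP[].
by rewrite -dvdn_divisors // => kn npk; rewrite moebius_mul_prime // (dvdn_gt0 n_gt0).
Qed.

(** Expanding [h] and exchanging the sums leaves, for each odd [e], the Moebius sum over the
    divisors of [e], all of them odd; only e = 1 survives. *)
Lemma odd_moebius_inversion (g h : nat -> int) :
  (forall m, (0 < m)%N -> \sum_(k <- divisors m | odd k) g (m %/ k)%N = h m) ->
  forall m, (0 < m)%N ->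
    g m = \sum_(d <- divisors m | odd d) moebius d * h (m %/ d)%N.
Proof.
move=> gh m m_gt0; symmetry.
have inner d : d \in divisors m -> odd d -> h (m %/ d)%N =
    \sum_(e <- divisors m | odd e && (d %| e)%N) g (m %/ e)%N.
  rewrite -dvdn_divisors // => dm oddd; have d_gt0 := dvdn_gt0 m_gt0 dm.
  have md_gt0 : (0 < m %/ d)%N by rewrite divn_gt0 // dvdn_leq.
  rewrite -(gh _ md_gt0) [RHS]big_mkcondl -[RHS]big_filter.
  rewrite -[RHS](perm_big _ (perm_divisors_mul m_gt0 dm)) big_map [LHS]big_mkcond.
  by apply: eq_bigr => k _; rewrite oddM oddd divnMA.
rewrite big_seq_cond.
under eq_bigr => d /andP[dm oddd] do rewrite (inner d dm oddd) mulr_sumr.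
rewrite -big_seq_cond (exchange_big_dep (fun e => odd e)) /=; last first.
  by move=> d e _ /andP[].
have inner_moebius e : e \in divisors m -> odd e ->
    \sum_(d <- divisors m | [&& odd d, odd e & d %| e]%N) moebius d =
    (e == 1%N)%:R.
  rewrite -dvdn_divisors // => em odde; have e_gt0 := dvdn_gt0 m_gt0 em.
  rewrite -sum_moebius // -big_filter; apply: perm_big.
  apply: uniq_perm => [||d]; rewrite ?filter_uniq ?divisors_uniq //.
  rewrite mem_filter odde -!dvdn_divisors //=.
  apply/andP/idP => [[/andP[]]|de] //.
  by rewrite de (dvdn_odd de odde) (dvdn_trans de em).
rewrite big_seq_cond.
under eq_bigr => e /andP[em odde] do rewrite -mulr_suml inner_moebius //.
rewrite -big_seq_cond big_mkcond (bigD1_seq 1%N) ?divisor1 ?divisors_uniq //=.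
rewrite mul1r divn1 big1 ?addr0 // => e /negPf->.
by rewrite mul0r if_same.
Qed.

(** * The counting identities in the form required for inversion *)

Lemma sum_codiv_Irr n : (0 < n)%N ->
  \sum_(k <- divisors n) (n %/ k)%:Z * #|Irr (n %/ k)|%:Z = (2 ^ n)%N%:Z.
Proof.
move=> n_gt0; rewrite (sum_codiv xpredT (fun d => d%:Z * #|Irr d|%:Z)) //.
by rewrite -sum_card_Irr // (big_morph Posz PoszD (erefl _)).
Qed.

Lemma sum_codiv_IrrTr1 n : (0 < n)%N ->
  \sum_(k <- divisors n | odd k) (n %/ k)%:Z * #|IrrTr1 (n %/ k)|%:Z =
  (2 ^ n.-1)%N%:Z.
Proof.
move=> n_gt0; rewrite (sum_codiv odd (fun d => d%:Z * #|IrrTr1 d|%:Z)) //.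
by rewrite -sum_card_IrrTr1 // (big_morph Posz PoszD (erefl _)).
Qed.

Lemma odd_divisors_double (m : nat) (F : nat -> int) : (0 < m)%N ->
  \sum_(k <- divisors m.*2 | odd k) F k = \sum_(k <- divisors m | odd k) F k.
Proof.
move=> m_gt0; rewrite -big_filter -[RHS]big_filter; apply: perm_big.
apply: uniq_perm => [||k]; rewrite ?filter_uniq ?divisors_uniq // !mem_filter.
case oddk: (odd k) => //=; rewrite -!dvdn_divisors ?double_gt0 //.
by rewrite -muln2 Gauss_dvdl // coprimen2.
Qed.

(** The even divisors of 2m are the 2k with k dividing m, and 2m/(2k) = m/k, so this is the full
    count in degree m. *)
Lemma sum_even_codiv_Irr m : (0 < m)%N ->
  \sum_(k <- divisors m.*2 | ~~ odd k)
    (m.*2 %/ k)%:Z * #|Irr (m.*2 %/ k)|%:Z = (2 ^ m)%N%:Z.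
Proof.
move=> m_gt0; have m2_gt0 : (0 < m.*2)%N by rewrite double_gt0.
have two_dvd : (2 %| m.*2)%N by rewrite -mul2n dvdn_mulr.
rewrite (eq_bigl (fun k => 2 %| k)%N) => [|k]; last by rewrite dvdn2.
rewrite -big_filter -(perm_big _ (perm_divisors_mul m2_gt0 two_dvd)) big_map.
rewrite -{1}mul2n mulKn // -sum_codiv_Irr //; apply: eq_bigr => k _.
by rewrite -mul2n divnMl.
Qed.

Theorem theorem2 (n : nat) (hn : (2 <= n)%N) (heven : ~~ odd n) :
  ((#|Sij n 1 1|%:Z - #|Sij n 0 0|%:Z) = #|IrrTr1 n./2|%:Z)
  /\ ((#|Sij n 1 1|%:Z - #|Sij n 0 0|%:Z)%:~R : rat)
     = (n%:R)^-1 * \sum_(d <- divisors n./2 | odd d)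
                     (moebius d)%:~R * (2 ^ (n %/ (2 * d)))%N%:R.
Proof.
have [m m_gt0 ->] : exists2 m, (0 < m)%N & n = m.*2.
  by exists n./2; rewrite ?half_gt0 // even_halfK.
have m2_gt1 : (1 < m.*2)%N by lia.
rewrite doubleK card_S11_sub_S00 //.
pose h (j : nat) := (2 ^ j)%N%:Z.
(* The weight 2j, rather than j, turns the 2^(j-1) of the trace count into 2^j; sharing it with [g2]
   lets it be cancelled at the end. *)
pose g1 j := j.*2%:Z * #|IrrTr1 j|%:Z.
pose g2 j := j.*2%:Z * (#|IrrTr1 j.*2|%:Z *+ 2 - #|Irr j.*2|%:Z).
have sum_g1 j : (0 < j)%N -> \sum_(k <- divisors j | odd k) g1 (j %/ k)%N = h j.
  move=> j_gt0.
  have -> : h j = 2 * (2 ^ j.-1)%N%:Z.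
    by rewrite /h -{1}(prednK j_gt0) expnS PoszM.
  rewrite -sum_codiv_IrrTr1 //.
  by rewrite mulr_sumr; apply: eq_bigr => k _; rewrite /g1 -mul2n PoszM mulrA.
have sum_g2 j : (0 < j)%N -> \sum_(k <- divisors j | odd k) g2 (j %/ k)%N = h j.
  move=> j_gt0; have j2_gt0 : (0 < j.*2)%N by rewrite double_gt0.
  (* The divisors of 2j give 2^(2j) in all and the even ones 2^j, while twice the trace count is
     again 2^(2j); subtracting the odd part leaves 2^j. *)
  have := sum_codiv_Irr j2_gt0; rewrite (bigID odd) /= sum_even_codiv_Irr //.
  have := sum_codiv_IrrTr1 j2_gt0; rewrite !odd_divisors_double //.
  have -> : \sum_(k <- divisors j | odd k) g2 (j %/ k)%N =
      (\sum_(k <- divisors j | odd k) (j.*2 %/ k)%:Z * #|IrrTr1 (j.*2 %/ k)|%:Z) *+ 2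
      - \sum_(k <- divisors j | odd k) (j.*2 %/ k)%:Z * #|Irr (j.*2 %/ k)|%:Z.
    rewrite -sumrMnl -sumrB big_seq_cond [RHS]big_seq_cond.
    apply: eq_bigr => k /andP[]; rewrite -dvdn_divisors // => kj _.
    by rewrite /g2 -mul2n -[j.*2]mul2n muln_divA // mulrBr mulrnAr.
  have doubleE : (2 ^ j.*2.-1)%N%:Z *+ 2 = (2 ^ j.*2)%N%:Z.
    by rewrite -[in RHS](prednK j2_gt0) expnS PoszM mulr2n; lia.
  by move=> -> sumI; rewrite doubleE -sumI addrAC subrr add0r.
(* Inversion expresses both values by the same sum in [h]. *)
have g12 : g1 m = g2 m.
  by rewrite (odd_moebius_inversion sum_g1) // (odd_moebius_inversion sum_g2).
have m2_neq0 : m.*2%:Z != 0 by lia.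
have T1E := mulfI m2_neq0 g12; rewrite -T1E; split=> //.
have := odd_moebius_inversion sum_g1 m_gt0.
move=> /(congr1 (fun z : int => z%:~R : rat)); rewrite rmorphM /= => g1E.
(* Multiplied by n = 2m, the second claim is the inversion formula for [g1], with n/(2d) = m/d. *)
apply: (@mulfI _ (m.*2%:R)); first by rewrite pnatr_eq0; lia.
rewrite mulVKf ?pnatr_eq0; last by lia.
rewrite [LHS]g1E rmorph_sum /=; apply: eq_bigr => d _.
by rewrite rmorphM /= /h -mul2n divnMl.
Qed.
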